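(* For $n\ge 1$, let $\mathbf{c}\in \mathrm{GF}(2)^n$, $d\in \mathrm{GF}(2)$, and let $p_l:\mathrm{GF}(2)^n\to\mathrm{GF}(2)$ be the line function in $n$ variables, $p_l(\mathbf{x})=\sum_{j=0}^{n-2}x_jx_{j+1}+\mathbf{c}\cdot\mathbf{x}+d$. Let $K_n$ be the number of flat spectra of $p_l$ with respect to $\{H,N\}^n$. Then $K_1=1$, $K_n=2^n-K_{n-1}$ for all $n\ge 2$, and in closed form $$K_n=\frac{1}{3}\left(2^{n+1}+(-1)^n\right)\qquad (n\ge 1).$$
   Context: Let $I$ be the $2\times 2$ identity matrix, $H=\frac{1}{\sqrt2}\begin{pmatrix}1&1\\1&-1\end{pmatrix}$, and $N=\frac{1}{\sqrt2}\begin{pmatrix}1&i\\1&-i\end{pmatrix}$ with $i^2=-1$. For $S\subseteq\{I,H,N\}$, $S^n$ denotes the set of $|S|^n$ transforms $U=U_0\otimes U_1\otimes\cdots\otimes U_{n-1}$ with each $U_j\in S$ (the factor $U_j$ acts on the tensor position of variable $x_j$); each transform is identified with the choice $(U_0,\ldots,U_{n-1})$. For a Boolean function $p:\mathrm{GF}(2)^n\to\mathrm{GF}(2)$, let $(-1)^{p}\in\mathbb{C}^{2^n}$ be the vector with entries $(-1)^{p(\mathbf{x})}$ indexed by $\mathbf{x}=(x_0,\ldots,x_{n-1})\in\mathrm{GF}(2)^n$. The spectrum of $p$ with respect to $U$ is $P=U(-1)^p=(P_{\mathbf{k}})_{\mathbf{k}\in\mathrm{GF}(2)^n}$, and it is flat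 if $|P_{\mathbf{k}}|=1$ for all $\mathbf{k}$. The number of flat spectra of $p$ with respect to $S^n$ is the number of choices $(U_0,\ldots,U_{n-1})\in S^n$ for which the spectrum of $p$ is flat. *)

(* Defs.v *)
From HB Require Import structures.
From mathcomp Require Import all_boot all_order all_algebra.
From mathcomp Require Import reals.
From mathcomp Require Import complex.

Set Implicit Arguments.
Unset Strict Implicit.
Unset Printing Implicit Defensive.

Import Order.TTheory GRing.Theory Num.Theory.
Local Open Scope ring_scope.

(* Labels for the three transforms, so that a subset of {I, H, N} is a finite
   set and the transforms over it can be counted as choices of labels. *)
Inductive gate := GateI | GateH | GateN.

Definition ord_of_gate (g : gate) : 'I_3 :=
  match g with
  | GateI => inord 0
  | GateH => inord 1
  | GateN => inord 2
  end.

Definition gate_of_ord (i : 'I_3) : gate :=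
  match val i with
  | 0 => GateI
  | 1 => GateH
  | _ => GateN
  end.

Lemma ord_of_gateK : cancel ord_of_gate gate_of_ord.
Proof. by case; rewrite /gate_of_ord /= inordK. Qed.

HB.instance Definition _ := Countable.copy gate (can_type ord_of_gateK).
HB.instance Definition _ : isFinite gate := CanIsFinite ord_of_gateK.

Definition mx2 (C : numClosedFieldType) (a00 a01 a10 a11 : C) : 'M[C]_2 :=
  \matrix_(k < 2, x < 2)
    if k == 0 then (if x == 0 then a00 else a01)
    else (if x == 0 then a10 else a11).

Definition gate_mx (C : numClosedFieldType) (g : gate) : 'M[C]_2 :=
  match g with
  | GateI => 1%:M
  | GateH => (sqrtC 2)^-1 *: mx2 1 1
                                 1 (-1)
  | GateN => (sqrtC 2)^-1 *: mx2 1 'i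
                                 1 (- 'i)
  end.

(* The entries of the tensor product U_0 (x) ... (x) U_(n-1), indexed by GF(2)^n
   rather than by 'I_(2 ^ n); 'F_2 is convertible to 'I_2, so that bits serve
   as matrix indices. *)
Definition tensor (C : numClosedFieldType) n (U : 'I_n -> 'M[C]_2)
    (k x : 'rV['F_2]_n) : C :=
  \prod_(j < n) U j (k 0 j) (x 0 j).

Definition sign_vector (C : numClosedFieldType) n (p : 'rV['F_2]_n -> 'F_2)
    (x : 'rV['F_2]_n) : C :=
  (-1) ^+ (p x).

Definition spectrum (C : numClosedFieldType) n (U : {ffun 'I_n -> gate})
    (p : 'rV['F_2]_n -> 'F_2) (k : 'rV['F_2]_n) : C :=
  \sum_(x : 'rV['F_2]_n)
    tensor (fun j => gate_mx C (U j)) k x * sign_vector C p x.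

Definition flat (C : numClosedFieldType) n (P : 'rV['F_2]_n -> C) : bool :=
  [forall k, `|P k| == 1].

Definition num_flat_spectra (C : numClosedFieldType) n (S : {set gate})
    (p : 'rV['F_2]_n -> 'F_2) : nat :=
  #|[set U : {ffun 'I_n -> gate} |
      (U \in ffun_on (mem S)) && flat (spectrum C U p)]|.

(* The double sum has one term x_i x_(i+1) for each i with i + 1 < n. *)
Definition line_function n (c : 'rV['F_2]_n) (d : 'F_2) (x : 'rV['F_2]_n)
    : 'F_2 :=
  \sum_(i < n) \sum_(j < n | j == i.+1 :> nat) x 0 i * x 0 j
  + \sum_(j < n) c 0 j * x 0 j + d.

Definition line_flat_HN (R : realType) n (c : 'rV['F_2]_n) (d : 'F_2) : nat :=
  num_flat_spectra R[i] [set GateH; GateN] (line_function c d).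

(* Main.v *)
(** Write a spectrum entry, up to a sign and the factor [2^(-n/2)], as a sum [A]
    over the bits [x], and let [B] be the same sum twisted by the sign
    [(-1)^(x_0)].  Adding a variable in front of the line replaces [(A, B)]
    by [(A + w B, A - w B)], where [w^2 = 1] for the gate [H] and [w^2 = -1]
    for [N].  Only three shapes
    of [(A, B)] occur: [B^2 = A^2], [B^2 = - A^2] and [A B = 0], while
    [|A|^2 + |B|^2 = 2^(n+1)] throughout; the spectrum is flat in the first two
    cases and not in the third.  From each of the first two shapes exactly one
    of the two gates leads to the third, and from the third neither does, so
    that the non-flat choices for [n + 1] variables correspond to the flat
    choices for [n] variables. *)

Require Import Defs.
From mathcomp Require Import all_boot all_order all_algebra.
From mathcomp Require Import reals complex.
From mathcomp Require Import ring.

Set Implicit Arguments.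
Unset Strict Implicit.
Unset Printing Implicit Defensive.

Import Order.TTheory GRing.Theory Num.Theory.
Local Open Scope ring_scope.

Lemma F2_cases (a : 'F_2) : a = 0 \/ a = 1.
Proof. by case: a => [[|[|//]] lt_a2]; [left | right]; apply: val_inj. Qed.

Lemma GateH_neq_GateN : (GateH == GateN) = false.
Proof. by apply/eqP. Qed.

Section Spectrum.

Variable C : numClosedFieldType.

Definition F2_sign (a : 'F_2) : C := (-1) ^+ a.

Lemma F2_signD a b : F2_sign (a + b) = F2_sign a * F2_sign b.
Proof.
rewrite /F2_sign; case: (F2_cases a) => ->; case: (F2_cases b) => ->;
  by rewrite ?addr0 ?add0r ?mulr1 ?mul1r //= ?expr0 ?expr1 ?mulrNN ?mulr1.
Qed.

Lemma F2_sign_sum n (F : 'I_n -> 'F_2) :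
  F2_sign (\sum_j F j) = \prod_j F2_sign (F j).
Proof. by apply: (big_morph F2_sign F2_signD). Qed.

Lemma F2_signM a b : F2_sign (a * b) = F2_sign a ^+ b.
Proof.
rewrite /F2_sign.
by case: (F2_cases a) => ->; case: (F2_cases b) => ->;
  rewrite ?mulr0 ?mul0r ?mulr1 ?expr0 ?expr1.
Qed.

Lemma sqr_F2_sign a : F2_sign a ^+ 2 = 1.
Proof. by rewrite /F2_sign sqrr_sign. Qed.

(** * Bit vectors and splitting off the first variable *)

Definition path_form n (x : 'rV['F_2]_n) : 'F_2 :=
  \sum_(i < n) \sum_(j < n | j == i.+1 :> nat) x 0 i * x 0 j.

(* The bit [x_0], or [0] when [n = 0]. *)
Definition head_bit n (x : 'rV['F_2]_n) : 'F_2 :=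
  \sum_(j < n | j == 0 :> nat) x 0 j.

Definition cons_bit n (a : 'F_2) (x : 'rV['F_2]_n) : 'rV['F_2]_n.+1 :=
  \row_j oapp (x 0) a (unlift ord0 j).

Lemma cons_bit0 n a (x : 'rV['F_2]_n) : cons_bit a x 0 ord0 = a.
Proof. by rewrite mxE unlift_none. Qed.

Lemma cons_bit_lift n a (x : 'rV['F_2]_n) j :
  cons_bit a x 0 (lift ord0 j) = x 0 j.
Proof. by rewrite mxE liftK. Qed.

Lemma head_bit_cons n a (x : 'rV['F_2]_n) : head_bit (cons_bit a x) = a.
Proof.
rewrite /head_bit big_mkcond big_ord_recl /= cons_bit0.
by rewrite big1 ?addr0.
Qed.

Lemma path_form_cons n a (x : 'rV['F_2]_n) :
  path_form (cons_bit a x) = a * head_bit x + path_form x.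
Proof.
rewrite /path_form big_ord_recl big_mkcond big_ord_recl /= add0r; congr (_ + _).
  rewrite /head_bit mulr_sumr [RHS]big_mkcond; apply: eq_bigr => j _.
  by rewrite cons_bit0 cons_bit_lift.
apply: eq_bigr => i _; rewrite big_mkcond big_ord_recl /= add0r [RHS]big_mkcond.
by apply: eq_bigr => j _; rewrite !cons_bit_lift.
Qed.

Lemma sum_cons_bit n (F : 'rV['F_2]_n.+1 -> C) :
  \sum_x F x = \sum_x F (cons_bit 0 x) + \sum_x F (cons_bit 1 x).
Proof.
rewrite (reindex (fun u : 'F_2 * 'rV['F_2]_n => cons_bit u.1 u.2)) /=.
  rewrite -(pair_bigA _ (fun a x => F (cons_bit a x))) /=.
  rewrite (bigD1 0) //= (bigD1 1) //=.
  rewrite [X in _ + (_ + X)]big1 ?addr0 // => a /andP[].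
  by case: (F2_cases a) => ->.
exists (fun x => (x 0 ord0, \row_j x 0 (lift ord0 j))) => [[a x]|x] _ /=.
  rewrite cons_bit0; congr (_, _).
  by apply/rowP => j; rewrite mxE cons_bit_lift.
apply/rowP => j; case: (unliftP ord0 j) => [k|] ->.
  by rewrite cons_bit_lift mxE.
by rewrite cons_bit0.
Qed.

(** * Weighted path sums and their shapes *)

Definition path_sum n (a : 'F_2) (w : 'I_n -> C) : C :=
  \sum_(x : 'rV['F_2]_n)
    F2_sign (a * head_bit x + path_form x) * \prod_j w j ^+ x 0 j.

Lemma path_sum0 a (w : 'I_0 -> C) : path_sum a w = 1.
Proof.
rewrite /path_sum (big_pred1 0) => [|x]; last by rewrite /= (thinmx0 x) eqxx.
by rewrite /head_bit /path_form !big_ord0 mulr0 addr0 mulr1 /F2_sign expr0.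
Qed.

(** Split on the first bit: setting it to 1 turns the edge [x_0 x_1] into the sign [(-1)^(x_1)],
    which is the twist [1] of the tail. *)
Lemma path_sumS n a (w : 'I_n.+1 -> C) :
  path_sum a w = path_sum 0 (w \o lift ord0)
                 + F2_sign a * w ord0 * path_sum 1 (w \o lift ord0).
Proof.
rewrite /path_sum sum_cons_bit mulr_sumr; congr (_ + _); apply: eq_bigr => x _;
  rewrite big_ord_recl cons_bit0 head_bit_cons path_form_cons;
  rewrite (eq_bigr (fun j => w (lift ord0 j) ^+ x 0 j)) => [|j _];
  rewrite ?cons_bit_lift //.
- by rewrite mulr0 add0r !mul0r expr0 mul1r.
- by rewrite mulr1 mul1r !F2_signD expr1 /=; ring.
Qed.

(* The states are read through [shape] below, with [A := path_sum 0 w] and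
   [B := path_sum 1 w]. *)
Definition step (g : gate) (s : option bool) : option bool :=
  if s is Some b then (if (g == GateN) == b then None else Some true)
  else Some false.

Fixpoint state n : ('I_n -> gate) -> option bool :=
  match n with
  | 0 => fun _ => Some false
  | _.+1 => fun U => step (U ord0) (state (U \o lift ord0))
  end.

Definition shape (s : option bool) (A B : C) : Prop :=
  if s is Some b then B ^+ 2 = (-1) ^+ b * A ^+ 2 else A * B = 0.

(** Only [w ^+ 2] matters, so the sign of [w] is free. If [(w * B) ^+ 2 = A ^+ 2], the new sums have
    product 0; if it is [- A ^+ 2], their squares are [2 w A B] and [- 2 w A B]; if [A * B = 0],
    both squares are [A ^+ 2 + (w * B) ^+ 2]. *)
Lemma shape_step g s A B w : w ^+ 2 = (-1) ^+ (g == GateN) ->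
  shape s A B -> shape (step g s) (A + w * B) (A - w * B).
Proof.
case: s => [b|] /= w2 sAB; last by rewrite expr0 mul1r; ring: sAB.
have wB2 : (w * B) ^+ 2 = (-1) ^+ ((g == GateN) (+) b) * A ^+ 2.
  by rewrite exprMn w2 sAB mulrA signr_addb.
case: (_ =P b) wB2 => [->|/eqP ne_gb].
  rewrite addbb expr0 mul1r /= => wB2.
  by rewrite mulrC -subr_sqr wB2 subrr.
rewrite (_ : _ (+) _ = true) /= ?expr1; last first.
  by case: (g == _) b ne_gb {sAB w2} => [] [].
by move=> wB2; ring: wB2.
Qed.

Lemma path_sum_shape n (U : 'I_n -> gate) (w : 'I_n -> C) :
    (forall j, w j ^+ 2 = (-1) ^+ (U j == GateN)) ->
  shape (state U) (path_sum 0 w) (path_sum 1 w).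
Proof.
elim: n U w => [|n IHn] U w w2 /=; first by rewrite !path_sum0 expr0 mul1r.
rewrite !(path_sumS _ w) /F2_sign expr0 expr1 mul1r mulN1r mulNr.
by apply: shape_step => //; apply: IHn => j; apply: w2.
Qed.

Lemma parallelogram (x y : C) :
  `|x + y| ^+ 2 + `|x - y| ^+ 2 = 2 * (`|x| ^+ 2 + `|y| ^+ 2).
Proof. by rewrite !normCK rmorphD rmorphB /=; ring. Qed.

(** By the parallelogram law, each new variable of unit weight doubles the total. *)
Lemma path_sum_norm n (w : 'I_n -> C) : (forall j, `|w j| = 1) ->
  `|path_sum 0 w| ^+ 2 + `|path_sum 1 w| ^+ 2 = 2 ^+ n.+1.
Proof.
elim: n w => [|n IHn] w w1; first by rewrite !path_sum0 normr1 expr1n.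
rewrite !(path_sumS _ w) /F2_sign expr0 expr1 mul1r mulN1r mulNr.
by rewrite parallelogram normrM w1 mul1r IHn => [|j /=]; rewrite -?exprS.
Qed.

(** A shape [Some b] forces equal norms, so each square is half the total. Under [None] one sum
    vanishes and the square of the norm of [A] is 0 or [2 * m], both different from [m]. *)
Lemma norm_shape s (A B m : C) : m != 0 -> shape s A B ->
  `|A| ^+ 2 + `|B| ^+ 2 = 2 * m -> (`|A| ^+ 2 == m) = (s != None).
Proof.
move=> m0; case: s => [b|] /=.
  move/(congr1 Num.norm); rewrite [in RHS]normrM normr_sign mul1r !normrX => ->.
  rewrite -mulr2n -[_ *+ 2]mulr_natl.
  by move=> /(mulfI _) ->; rewrite ?eqxx ?pnatr_eq0.
move=> /eqP; rewrite mulf_eq0 => /orP[]/eqP ->; rewrite normr0 expr0n /=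
  ?add0r ?addr0.
  by rewrite eq_sym (negbTE m0).
move=> ->; apply: contra_neqF m0 => /eqP m2.
by apply: (addrI m); rewrite addr0 -[RHS]m2; ring.
Qed.

(** * Spectrum entries as path sums *)

Definition gate_phase (g : gate) : C := if g == GateN then 'i else 1.

Lemma sqr_gate_phase g : gate_phase g ^+ 2 = (-1) ^+ (g == GateN).
Proof. by rewrite /gate_phase; case: eqP; rewrite ?sqrCi ?expr1n. Qed.

(** Both gates have a constant first column, so each row consists of the powers 0 and 1 of a single
    phase, up to scaling. *)
Lemma gate_mxE g (k x : 'F_2) : g \in [set GateH; GateN] ->
  gate_mx C g k x = (sqrtC 2)^-1 * (F2_sign k * gate_phase g) ^+ x.
Proof.
rewrite !inE => /orP[]/eqP ->; rewrite /gate_phase /F2_sign /= !mxE;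
  case: (F2_cases k) => ->; case: (F2_cases x) => ->;
  by rewrite /= ?eqxx ?GateH_neq_GateN ?expr0 ?expr1 ?mul1r ?mulr1 ?mulN1r.
Qed.

Lemma line_function_sign n (c : 'rV['F_2]_n) d x :
  F2_sign (line_function c d x) =
  F2_sign d * (F2_sign (path_form x) * \prod_j F2_sign (c 0 j) ^+ x 0 j).
Proof.
rewrite /line_function !F2_signD mulrC; congr (_ * (_ * _)).
by rewrite F2_sign_sum; apply: eq_bigr => j _; rewrite F2_signM.
Qed.

Lemma spectrum_line n (c : 'rV['F_2]_n) d (U : {ffun 'I_n -> gate}) k :
    U \in ffun_on (mem [set GateH; GateN]) ->
  spectrum C U (line_function c d) k =
  F2_sign d * (sqrtC 2) ^- n
  * path_sum 0 (fun j => F2_sign (k 0 j + c 0 j) * gate_phase (U j)).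
Proof.
move=> /ffun_onP HN; rewrite /spectrum /path_sum mulr_sumr.
apply: eq_bigr => x _; rewrite /tensor /sign_vector -/(F2_sign _).
rewrite (eq_bigr (fun j => (sqrtC 2)^-1 *
    (F2_sign (k 0 j) * gate_phase (U j)) ^+ x 0 j)) => [|j _]; last first.
  by rewrite gate_mxE ?HN.
rewrite line_function_sign big_split /= prodr_const card_ord -exprVn.
rewrite mul0r add0r.
rewrite [in RHS](eq_bigr (fun j =>
    (F2_sign (k 0 j) * gate_phase (U j)) ^+ x 0 j * F2_sign (c 0 j) ^+ x 0 j)).
  by rewrite big_split /=; ring.
by move=> j _; rewrite F2_signD mulrAC exprMn.
Qed.

(** The index [k] and the vector [c] change only the signs of the weights, hence not the shape, so
    one state decides all entries at once. *)
Lemma flat_line n (c : 'rV['F_2]_n) d (U : {ffun 'I_n -> gate}) :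
    U \in ffun_on (mem [set GateH; GateN]) ->
  flat (spectrum C U (line_function c d)) = (state U != None).
Proof.
move=> HN.
have flat_k k :
    (`|spectrum C U (line_function c d) k| == 1) = (state U != None).
  rewrite spectrum_line //; set w := fun j => _.
  have w2 j : w j ^+ 2 = (-1) ^+ (U j == GateN).
    by rewrite exprMn sqr_F2_sign mul1r sqr_gate_phase.
  have w1 j : `|w j| = 1.
    by apply/eqP; rewrite -sqrp_eq1 // -normrX w2 normr_sign.
  have two_n0 : 2 ^+ n != 0 :> C by rewrite expf_neq0 // pnatr_eq0.
  (* The scalar in front has squared norm [2 ^- n], so an entry has norm 1 exactly when the squared
     norm of the path sum is [2 ^+ n], half the total. *)
  rewrite -(norm_shape two_n0 (path_sum_shape w2)) -?exprS ?path_sum_norm //.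
  rewrite -sqrp_eq1 // !normrM normr_sign mul1r exprMn.
  rewrite -normrX -exprVn -exprM mulnC exprM exprVn sqrtCK.
  rewrite normrX normfV normr_nat exprVn.
  by rewrite mulrC (can2_eq (divfK two_n0) (mulfK two_n0) _ 1) mul1r.
by apply/forallP/idP => [/(_ 0)|sU k]; rewrite flat_k.
Qed.

End Spectrum.

(** * Recurrence for the number of flat choices *)

Section Counting.

Local Notation choices_HN n :=
  (ffun_on (mem [set GateH; GateN]) : pred {ffun 'I_n -> gate}).

Definition num_flat_states n : nat :=
  #|[set U : {ffun 'I_n -> gate} | (U \in choices_HN n) && (state U != None)]|.

(** This independence of [c] and [d] lets the recurrence compare lines with unrelated linear
    parts. *)
Lemma line_flat_HNE (R : realType) n (c : 'rV['F_2]_n) d :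
  line_flat_HN R c d = num_flat_states n.
Proof.
apply: eq_card => U; rewrite !inE; apply: andb_id2l => HN.
exact: flat_line.
Qed.

Definition cons_gate n (g : gate) (U : {ffun 'I_n -> gate}) :
    {ffun 'I_n.+1 -> gate} :=
  [ffun j => oapp U g (unlift ord0 j)].

Lemma cons_gate0 n g (U : {ffun 'I_n -> gate}) : cons_gate g U ord0 = g.
Proof. by rewrite ffunE unlift_none. Qed.

Lemma cons_gate_lift n g (U : {ffun 'I_n -> gate}) j :
  cons_gate g U (lift ord0 j) = U j.
Proof. by rewrite ffunE liftK. Qed.

Lemma eq_state n (U V : 'I_n -> gate) : U =1 V -> state U = state V.
Proof.
elim: n U V => //= n IHn U V eqUV.
by rewrite eqUV (IHn _ (V \o lift ord0)) // => j; apply: eqUV.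
Qed.

Lemma card_choices_HN n : #|choices_HN n| = (2 ^ n)%N.
Proof. by rewrite card_ffun_on cards2 GateH_neq_GateN card_ord. Qed.

(* Arbitrary for [s = None], which no gate sends to [None]. *)
Definition bad_gate (s : option bool) : gate :=
  if s is Some true then GateN else GateH.

Lemma step_None g s : g \in [set GateH; GateN] ->
  (step g s == None) = (s != None) && (g == bad_gate s).
Proof.
rewrite !inE => /orP[]/eqP ->; case: s => [[]|] /=;
  by rewrite ?eqxx ?GateH_neq_GateN // [RHS]eq_sym GateH_neq_GateN.
Qed.

(** A non-flat choice is determined by its tail: the tail must be flat, and its state fixes the only
    first gate leading to [None]. *)
Lemma card_bad_choices n :
  #|[set U : {ffun 'I_n.+1 -> gate} |
      (U \in choices_HN n.+1) && (state U == None)]|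
  = num_flat_states n.
Proof.
rewrite /num_flat_states.
pose extend (V : {ffun 'I_n -> gate}) := cons_gate (bad_gate (state V)) V.
have extend_inj : injective extend.
  move=> V W /ffunP eqVW; apply/ffunP => j.
  by have := eqVW (lift ord0 j); rewrite !cons_gate_lift.
rewrite -(card_imset _ extend_inj).
apply: eq_card => U; rewrite !inE; apply/andP/imsetP => [[/ffun_onP HN]|[V]] /=.
  rewrite step_None ?HN // => /andP[sU /eqP U0].
  have tailE : [ffun j => U (lift ord0 j)] =1 U \o lift ord0.
    by move=> j; rewrite ffunE.
  exists [ffun j => U (lift ord0 j)].
    rewrite !inE (eq_state tailE) sU andbT.
    by apply/ffun_onP => j; rewrite ffunE HN.
  apply/ffunP => j; case: (unliftP ord0 j) => [i|] ->.
    by rewrite cons_gate_lift ffunE.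
  by rewrite cons_gate0 (eq_state tailE).
rewrite inE => /andP[/ffun_onP HN sV] ->.
have HN0 : bad_gate (state V) \in [set GateH; GateN].
  by case: (state V) => [[]|]; rewrite !inE eqxx ?orbT.
have tailE : cons_gate (bad_gate (state V)) V \o lift ord0 =1 V.
  by move=> j; rewrite /= cons_gate_lift.
split; last by rewrite cons_gate0 (eq_state tailE) step_None // sV eqxx.
apply/ffun_onP => j; case: (unliftP ord0 j) => [i|] ->.
  by rewrite cons_gate_lift HN.
by rewrite cons_gate0.
Qed.

Lemma num_flat_statesS n :
  (num_flat_states n.+1 + num_flat_states n = 2 ^ n.+1)%N.
Proof.
rewrite -(card_bad_choices n) -card_choices_HN addnC.
pose dead := [pred U : {ffun 'I_n.+1 -> gate} | state U == None].
rewrite -(cardID dead (choices_HN n.+1)).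
by congr (_ + _)%N; apply: eq_card => U; rewrite !inE // andbC.
Qed.

(** The empty line is the base of the recurrence; the value 1 for one variable then arises as
    [2 - 1]. *)
Lemma num_flat_states0 : num_flat_states 0 = 1%N.
Proof.
rewrite -(expn0 2) -card_choices_HN; apply: eq_card => U.
by rewrite inE andbT.
Qed.

Lemma num_flat_states_rec n :
  (num_flat_states n.+1)%:R = 2 ^+ n.+1 - (num_flat_states n)%:R :> rat.
Proof. by rewrite -natrX -num_flat_statesS natrD addrK. Qed.

Lemma num_flat_states_closed n :
  (num_flat_states n)%:R = 1 / 3 * (2 ^+ n.+1 + (-1) ^+ n) :> rat.
Proof.
elim: n => [|n IHn]; first by rewrite num_flat_states0.
by rewrite num_flat_states_rec IHn !exprS; field.
Qed.

End Counting.

Theorem lemma1 (R : realType) :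
  (forall (c : 'rV['F_2]_1) (d : 'F_2), line_flat_HN R c d = 1%N)
  /\ (forall n : nat, (2 <= n)%N ->
      forall (c : 'rV['F_2]_n) (d : 'F_2) (c' : 'rV['F_2]_n.-1) (d' : 'F_2),
        (line_flat_HN R c d)%:R
        = 2 ^+ n - (line_flat_HN R c' d')%:R :> rat)
  /\ (forall n : nat, (1 <= n)%N ->
      forall (c : 'rV['F_2]_n) (d : 'F_2),
        (line_flat_HN R c d)%:R
        = 1 / 3 * (2 ^+ n.+1 + (-1) ^+ n) :> rat).
Proof.
split=> [c d|].
  rewrite line_flat_HNE; have := num_flat_statesS 0.
  by rewrite num_flat_states0 addn1 => -[].
split=> [[//|n] _ c d c' d'|n _ c d]; rewrite !line_flat_HNE.
  exact: num_flat_states_rec.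
exact: num_flat_states_closed.
Qed.
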